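(* Let $T$ be a tree (finite or infinite). Then the following statements are equivalent: (i) The vertex set $V(T)$ is countable, i.e. $|V(T)| \leq \aleph_0$. (ii) For every non-degenerate labeling $l \colon V(T) \to \mathbb{R}^+$, the ultrametric space $(V(T), d_l)$ is separable. (iii) There exists a labeling $l \colon V(T) \to \mathbb{R}^+$ such that $(V(T), d_l)$ is a separable ultrametric space (that is, $d_l$ is an ultrametric on $V(T)$ and $(V(T), d_l)$ is separable).
   Context: Graphs are simple and undirected: $G=(V(G),E(G))$ with $E(G)$ a set of unordered pairs of distinct vertices; vertex sets may be infinite of any cardinality. A tree is a connected graph with nonempty vertex set and no cycles; any two distinct vertices of a tree are joined by exactly one (finite) path. $\mathbb{R}^+ = [0,\infty)$. A labeling of a tree $T$ is a map $l \colon V(T)\to\mathbb{R}^+$; it is non-degenerate if $\max\{l(u),l(v)\}>0$ for every edge $\{u,v\}\in E(T)$. Given a labeling $l$, define $d_l\colon V(T)\times V(T)\to\mathbb{R}^+$ by $d_l(u,u)=0$ and, for $u\neq v$, $d_l(u,v)=\max_{w\in V(P)} l(w)$, where $P$ is the path joining $u$ and $v$ in $T$ (endpoints included). It is known that $d_l$ is an ultrametric on $V(T)$ if and only if $l$ is non-degenerate. An ultrametric is a metric satisfying $d(x,y)\le\max\{d(x,z),d(z,y)\}$ for all $x,y,z$. A set is countable if its cardinality is at most $\aleph_0$ (finite sets included). A metric space is separable if it has a countable dense subset. *)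

(* Defs.v *)
From HB Require Import structures.
From mathcomp Require Import all_boot all_order all_algebra.
From mathcomp Require Import all_classical all_reals all_analysis.

Set Implicit Arguments.
Unset Strict Implicit.
Unset Printing Implicit Defensive.

Import Order.TTheory GRing.Theory Num.Theory.

Local Open Scope classical_set_scope.
Local Open Scope ring_scope.

(** A graph is an adjacency relation on its type of vertices. Asking for a
    [choiceType] and a boolean relation costs no generality: with the axioms of
    [boolp] every type is a [choiceType] and every proposition is reflected by a
    boolean. *)

Definition simple_graph (V : choiceType) (E : rel V) : Prop :=
  symmetric E /\ irreflexive E.

Definition connected_graph (V : choiceType) (E : rel V) : Prop :=
  forall u v : V, exists p : seq V, path E u p /\ last u p = v.

(** [ucycle] also accepts [::] and, on an edge {x, y}, the sequence [:: x; y];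
    the cycles of a graph are those with at least three vertices. *)
Definition acyclic_graph (V : choiceType) (E : rel V) : Prop :=
  ~ exists c : seq V, ucycle E c /\ (3 <= size c)%N.

Definition is_tree (V : choiceType) (E : rel V) : Prop :=
  [/\ simple_graph E, [set: V] !=set0, connected_graph E & acyclic_graph E].

(** The path is [u :: p]: as in [path], its first vertex [u] is kept apart. *)
Definition joins (V : choiceType) (E : rel V) (u v : V) (p : seq V) : Prop :=
  [/\ path E u p, last u p = v & uniq (u :: p)].

(** A [p] such that [joins E u v p] ([::] if there is none); in a tree it is the
    only one, see [tree_pathE]. *)
Definition tree_path (V : choiceType) (E : rel V) (u v : V) : seq V :=
  xget [::] [set p | joins E u v p].

Definition nondegenerate_labeling (R : realType) (V : choiceType) (E : rel V)
    (l : V -> {nonneg R}) : Prop :=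
  forall u v : V, E u v -> 0 < Num.max (l u)%:num (l v)%:num.

(** The neutral element 0 does not affect the maximum, as labels are
    nonnegative. *)
Definition dist_label (R : realType) (V : choiceType) (E : rel V)
    (l : V -> {nonneg R}) (u v : V) : R :=
  if u == v then 0
  else \big[Num.max/0]_(w <- u :: tree_path E u v) (l w)%:num.

Definition is_ultrametric (R : realType) (V : Type) (d : V -> V -> R) : Prop :=
  [/\ forall x y, 0 <= d x y,
      forall x y, d x y = 0 <-> x = y,
      forall x y, d x y = d y x,
      forall x y z, d x y <= d x z + d z y &
      forall x y z, d x y <= Num.max (d x z) (d z y)].

Section UltraSpace.
Context (R : realType) (V : choiceType) (d : V -> V -> R).

(** The type [V] with the [metricType] structure, hence the topology, of [d]. *)
Definition ultrametric_space (_ : is_ultrametric d) : Type := V.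

Variable dU : is_ultrametric d.

Let dxx (x : V) : d x x = 0.
Proof. by case: dU => _ d0 _ _ _; apply/d0. Qed.

Let d_eq0 (x y : V) : d x y = 0 -> x = y.
Proof. by case: dU => _ d0 _ _ _ /d0. Qed.

Let d_sym (x y : V) : d x y = d y x.
Proof. by case: dU. Qed.

Let d_triangle (y x z : V) : d x z <= d x y + d y z.
Proof. by case: dU. Qed.

HB.instance Definition _ := Choice.copy (ultrametric_space dU) V.
HB.instance Definition _ :=
  isMetric.Build R (ultrametric_space dU) dxx d_eq0 d_sym d_triangle.

End UltraSpace.

Definition separable_space (T : topologicalType) : Prop :=
  exists2 D : set T, countable D & dense D.

Section TreeTheory.
Context (V : choiceType) (E : rel V).
Hypothesis treeE : is_tree E.

Let symE : symmetric E. Proof. by case: treeE => -[]. Qed.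

Lemma joins_exists (u v : V) : exists p, joins E u v p.
Proof.
case: treeE => _ _ /(_ u v)[p [Ep <-]] _.
by case: (shortenP Ep) => q Eq uq _; exists q.
Qed.

Lemma rev_walk (u : V) (p : seq V) : path E u p ->
  path E (last u p) (rev (belast u p)).
Proof. by move=> Ep; rewrite rev_path (eq_path (e' := E)). Qed.

Lemma last_rev_walk (u : V) (p : seq V) :
  last (last u p) (rev (belast u p)) = u.
Proof. by case: p => //= a p; rewrite rev_cons last_rcons. Qed.

Lemma mem_rev_walk (u : V) (p : seq V) :
  last u p :: rev (belast u p) =i u :: p.
Proof. by move=> x; rewrite inE mem_rev lastI mem_rcons inE. Qed.

Lemma joins_uniq (u v : V) (p q : seq V) :
  joins E u v p -> joins E u v q -> p = q.
Proof.
elim: p u q => [|a p IHp] u [|b q] [] //=.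
- move=> _ <- _ [_ lq]; rewrite -{1}lq => /=.
  by rewrite mem_last.
- by move=> _ lp /andP[up _] [_ /= vu _]; move: up; rewrite vu -lp mem_last.
move=> /andP[Eua Ep] lp /andP[up uap] [/= /andP[Eub Eq] lq /andP[uq ubq]].
have [ab|ab] := eqVneq a b.
  by rewrite -ab in lq ubq Eq *; congr cons; apply: (IHp a).
case: treeE => _ _ _ []; pose w := p ++ rev (belast b q).
have Ew : path E a w by rewrite cat_path Ep /= lp -lq rev_walk.
have lw : last a w = b by rewrite last_cat lp -lq last_rev_walk.
have uw : u \notin a :: w.
  rewrite -cat_cons mem_cat negb_or up /=; apply: contra uq => uq.
  by rewrite -mem_rev_walk inE uq orbT.
case: (shortenP Ew) (lw) => s Es us sw ls; exists (u :: a :: s); split; last first.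
  by case: s ls {Es us sw} => //= /eqP; rewrite (negPf ab).
apply/andP; split; first by rewrite /= Eua rcons_path Es /= ls symE.
rewrite cons_uniq us andbT; apply: contra uw; rewrite !inE.
by case/orP => [->//|/sw ->]; rewrite orbT.
Qed.

Lemma tree_pathP (u v : V) : joins E u v (tree_path E u v).
Proof. by have [p pP] := joins_exists u v; apply: (xgetPex _ (ex_intro _ p pP)). Qed.

Lemma tree_pathE (u v : V) (p : seq V) : joins E u v p -> tree_path E u v = p.
Proof. by apply: joins_uniq; exact: tree_pathP. Qed.

Lemma tree_path_sub_walk (u v : V) (p : seq V) : path E u p -> last u p = v ->
  {subset u :: tree_path E u v <= u :: p}.
Proof.
move=> Ep <-; case: (shortenP Ep) => q Eq uq qp.
rewrite (@tree_pathE _ _ q)// => x; rewrite !inE => /orP[->//|/qp ->].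
by rewrite orbT.
Qed.

Context (R : realType) (l : V -> {nonneg R}).

Lemma dist_label_le (u v : V) (c : R) : 0 <= c ->
  {in u :: tree_path E u v, forall w, (l w)%:num <= c} ->
  dist_label E l u v <= c.
Proof.
move=> c0 lc; rewrite /dist_label; case: ifP => // _.
by rewrite big_seq; elim/big_ind: _ => // x y; rewrite ge_max => -> ->.
Qed.

Lemma label_le_dist (u v w : V) : u != v ->
  w \in u :: tree_path E u v -> (l w)%:num <= dist_label E l u v.
Proof.
by move=> uv wp; rewrite /dist_label (negPf uv); apply: le_bigmax_seq wp _.
Qed.

Lemma dist_label_ge0 (u v : V) : 0 <= dist_label E l u v.
Proof.
have [->|uv] := eqVneq u v; first by rewrite /dist_label eqxx.
by apply: le_trans (label_le_dist uv (mem_head _ _)).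
Qed.

Lemma dist_label_strong (x y z : V) :
  dist_label E l x y <= Num.max (dist_label E l x z) (dist_label E l z y).
Proof.
have [->|xz] := eqVneq x z; first by rewrite le_max lexx orbT.
have [->|zy] := eqVneq z y; first by rewrite le_max lexx.
apply: dist_label_le => [|w]; first by rewrite le_max dist_label_ge0.
have [Exz lxz _] := tree_pathP x z; have [Ezy lzy _] := tree_pathP z y.
have sub := @tree_path_sub_walk x y (tree_path E x z ++ tree_path E z y).
rewrite cat_path last_cat Exz lxz Ezy lzy in sub.
move=> /(sub isT erefl); rewrite -cat_cons mem_cat le_max => /orP[wp|wp].
  by rewrite label_le_dist.
by rewrite (@label_le_dist z y)// ?orbT// inE wp orbT.
Qed.

Lemma dist_label_sym_le (x y : V) : dist_label E l x y <= dist_label E l y x.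
Proof.
have [->//|xy] := eqVneq x y.
apply: dist_label_le => [|w wp]; first exact: dist_label_ge0.
apply: label_le_dist; first by rewrite eq_sym.
have [Eyx lyx _] := tree_pathP y x.
rewrite -mem_rev_walk lyx; apply: tree_path_sub_walk wp.
  by rewrite -[X in path _ X _]lyx rev_walk.
by rewrite -[X in last X _]lyx last_rev_walk.
Qed.

Lemma dist_label_ultrametric : nondegenerate_labeling E l ->
  is_ultrametric (dist_label E l).
Proof.
move=> nd; split; [exact: dist_label_ge0| | | |exact: dist_label_strong].
- move=> x y; split=> [d0|->]; last by rewrite /dist_label eqxx.
  apply/eqP/negPn/negP => xy; have lx := label_le_dist xy (mem_head _ _).
  have [] := tree_pathP x y.
  case Dp: (tree_path E x y) => [|a p] /=; first by move=> _ /eqP; rewrite (negPf xy).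
  move=> /andP[/nd + _] _ _; rewrite lt_max.
  have la : (l a)%:num <= dist_label E l x y.
    by apply: label_le_dist => //; rewrite Dp !inE eqxx orbT.
  by rewrite d0 in lx la; case/orP; rewrite ltNge ?lx ?la.
- by move=> x y; apply/eqP; rewrite eq_le !dist_label_sym_le.
- move=> x y z; apply: le_trans (dist_label_strong x y z) _.
  by rewrite ge_max lerDl lerDr !dist_label_ge0.
Qed.

End TreeTheory.

(* Main.v *)
Require Import Defs.
From mathcomp Require Import all_boot all_order all_algebra.
From mathcomp Require Import all_classical all_reals all_analysis.

(** Only (iii) => (i) has content: the whole vertex set is dense for (i) => (ii),
    and the labeling constantly equal to 1 witnesses (ii) => (iii).

    A countable dense set [D] may miss vertices, namely some of those with
    label 0, so the points of [D] are made to capture the others through a root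
    [r]. Let [v] be a vertex other than [r] and [p] the first vertex after [v]
    on the path from [v] to [r]. By density some [x] in [D] is at distance less
    than [d v p] from [v], and then [p] is not on the path from [v] to [x], as
    the maximum of the labels along a path only grows when the path is extended
    ([dist_label_neighbor_le]). In a tree this forces [v] to lie on the path
    from [r] to [x] ([mem_path_or_first_step]). Hence the finite paths from [r]
    to the points of [D] cover all the vertices, which are thus countable. *)

Set Implicit Arguments.
Unset Strict Implicit.
Unset Printing Implicit Defensive.

Import Order.TTheory GRing.Theory Num.Theory.

Local Open Scope classical_set_scope.
Local Open Scope ring_scope.

Section RootedTree.
Context (V : choiceType) (E : rel V).
Hypothesis T : is_tree E.

(** Otherwise [p], then [r], then [x] are joined by a walk avoiding [v], and
    prepending [v] to the simple path extracted from it gives the path from [v]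
    to [x]. *)
Lemma mem_path_or_first_step (r v p x : V) (q : seq V) :
  joins E v r (p :: q) ->
  v \in r :: tree_path E r x \/ p \in tree_path E v x.
Proof.
move=> [/= /andP[Evp Eq] lq /andP[vq _]].
have [|vx] := boolP (v \in r :: tree_path E r x); [by left|right].
have [Es ls _] := tree_pathP T r x.
pose w := q ++ tree_path E r x.
have Ew : path E p w by rewrite cat_path Eq lq.
have lw : last p w = x by rewrite last_cat lq.
have vw : v \notin p :: w.
  rewrite -cat_cons mem_cat negb_or vq /=.
  by apply: contra vx; rewrite inE orbC => ->.
case: (shortenP Ew) lw => s Eps us sw lsx.
rewrite (tree_pathE T (p := p :: s)) ?mem_head//.
split=> //=; first by rewrite Evp.
apply/andP; split; last exact: us.
by apply: contra vw; rewrite !inE => /orP[->//|/sw->]; rewrite orbT.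
Qed.

Lemma dist_label_neighbor_le (R : realType) (l : V -> {nonneg R}) (v p x : V) :
  E v p -> v != x -> p \in tree_path E v x ->
  dist_label E l v p <= dist_label E l v x.
Proof.
move=> Evp vx px; apply: dist_label_le => [|w]; first exact: dist_label_ge0.
have sub : {subset v :: tree_path E v p <= [:: v; p]}.
  by apply: tree_path_sub_walk => //=; rewrite Evp.
move=> /sub; rewrite !inE => /orP[]/eqP->; apply: label_le_dist => //.
  exact: mem_head.
by rewrite inE px orbT.
Qed.

(** When [v] is not [r], the distance from [v] to its neighbor [p] towards [r]
    is a suitable radius: a path from [v] that leaves the branch hanging from
    [v] goes through [p]. *)
Lemma path_from_root_near (R : realType) (l : V -> {nonneg R}) (r v : V) :
  is_ultrametric (dist_label E l) ->
  exists2 e : R, 0 < e &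
    forall x, dist_label E l v x < e -> v \in r :: tree_path E r x.
Proof.
move=> [d_ge0 d_eq0 _ _ _].
have [->|vr] := eqVneq v r; first by exists 1 => // x _; exact: mem_head.
have vrJ := tree_pathP T v r.
case: (tree_path E v r) vrJ => [|p q] vrJ.
  by case: vrJ => _ /= vr' _; rewrite vr' eqxx in vr.
have [/= /andP[Evp _] _ /andP[vpq _]] := vrJ.
exists (dist_label E l v p) => [|x].
  rewrite lt_neqAle d_ge0 andbT eq_sym; apply: contra vpq => /eqP/d_eq0->.
  exact: mem_head.
have [<- _|vx dvx] := eqVneq v x.
  by have [_ lrv _] := tree_pathP T r v; rewrite -{1}lrv mem_last.
have [//|px] := mem_path_or_first_step x vrJ.
by move: dvx; rewrite ltNge dist_label_neighbor_le.
Qed.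

End RootedTree.

Theorem theorem2 (R : realType) (V : choiceType) (E : rel V) (T : is_tree E) :
  [<-> countable [set: V];
       forall (l : V -> {nonneg R}) (nd : nondegenerate_labeling E l),
         separable_space (ultrametric_space (dist_label_ultrametric T nd));
       exists (l : V -> {nonneg R}) (dU : is_ultrametric (dist_label E l)),
         separable_space (ultrametric_space dU)].
Proof.
tfae.
- by move=> cV l nd; exists [set: V] => // O O0 _; rewrite setIT.
- move=> sep; have nd : nondegenerate_labeling E (fun=> 1%:nng : {nonneg R}).
    by move=> u v _; rewrite lt_max ltr01.
  by exists (fun=> 1%:nng), (dist_label_ultrametric T nd); exact: sep.
- move=> [l [dU [D cD denseD]]].
  have [_ [r _] _ _] := T.
  apply: (@sub_countable _ _ _
    (\bigcup_(x in (D : set V)) [set` r :: tree_path E r x])).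
    apply: subset_card_le => v _.
    have [e e0 near_v] := path_from_root_near T r v dU.
    have [x [Dx vx]] : D `&` ball (v : ultrametric_space dU) e !=set0.
      pose B : set (ultrametric_space dU) := ball (v : ultrametric_space dU) e.
      have [|x [/interior_subset vx Dx]] := denseD B° _ (@open_interior _ B).
        by exists v; exact: nbhsx_ballx.
      by exists x.
    by exists x => //; apply: near_v; move: vx; rewrite ballEmdist.
  by apply: bigcup_countable => // x _; exact/finite_set_countable/finite_seq.
Qed.
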